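(* Let $h\ge 1$ and let $p_h^U(W)$ be the probability that a growing self-avoiding walk $W$ on $\mathcal G_h$ occurs under the uniform model. Then the generating function $$f_h^U(x,y)=\sum_{W\in W_{(0,h-1)}(\mathcal G_h)}p_h^U(W)\,x^{|W|}y^{\|W\|}$$ that counts GSAWs on $\mathcal G_h$ that start in the top-left corner $(0,h-1)$ by length and displacement is rational.
   Context: $\mathcal G_h$ is the half-infinite grid graph with vertex set $\mathbb N\times\{0,\dots,h-1\}$ ($0\in\mathbb N$), with an edge between two points exactly when they are at Euclidean distance $1$. A growing self-avoiding walk (GSAW) on a graph is a finite directed walk that visits no vertex twice and whose final vertex is trapped, i.e. all of its neighbors are visited by the walk. $W_v(G)$ denotes the set of GSAWs on $G$ starting at the vertex $v$. $|W|$ is the length of $W$ (number of edges) and $\|W\|$ is its displacement (difference between the largest and smallest $x$-coordinates of its vertices). Uniform model: at each step the next vertex is chosen uniformly at random among the not-yet-visited neighbors of the current endpoint; thus $p_h^U(W)$ is the product over the steps of $W$ of $1/m$, where $m$ is the number of unvisited neighbors of the current endpoint just before that step. ''Rational'' means that the formal power series equals a quotient of two polynomials. *)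

(* Defs.v *)
From HB Require Import structures.
From mathcomp Require Import all_boot all_order all_algebra finmap.
From mathcomp Require Import boolp classical_sets functions cardinality fsbigop.

Set Implicit Arguments.
Unset Strict Implicit.
Unset Printing Implicit Defensive.

Import Order.TTheory GRing.Theory Num.Theory.
Local Open Scope classical_set_scope.
Local Open Scope ring_scope.

(* A walk is encoded by its starting vertex v and the list p of the vertices
   visited after v; its number of edges is [size p]. *)
Section GrowingWalks.
Variables (V : choiceType) (adj : rel V).

Definition gsaws (v : V) : set (seq V) :=
  [set p | [/\ path adj v p, uniq (v :: p)
             & forall u, adj (last v p) u -> u \in v :: p]].

(* [fset_set] is meaningful on finite sets only, so this is the intended number
   when adj is locally finite (see [finite_grid_nbrs]). *)
Definition num_unvisited (visited : seq V) (c : V) : nat :=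
  #|` fset_set [set u | adj c u /\ u \notin visited] |%fset.

Definition uniform_prob (v : V) (p : seq V) : rat :=
  \prod_(i < size p)
    (num_unvisited (take i.+1 (v :: p)) (nth v (v :: p) i))%:R^-1.

Lemma finite_walks :
  (forall u, finite_set [set w | adj u w]) ->
  forall n v, finite_set [set p | path adj v p /\ size p = n].
Proof.
move=> fin_adj; elim=> [|n IHn] v.
  by apply: (sub_finite_set _ (finite_set1 [::])) => p /= [_ /size0nil ->].
have: finite_set (\bigcup_(u in [set w | adj v w])
          (cons u @` [set p | path adj u p /\ size p = n])).
  by apply: bigcup_finite => // u _; apply: finite_image.
apply: sub_finite_set => -[|u p] [] //= /andP[vu up] [sp].
by exists u => //; exists p.
Qed.

End GrowingWalks.

Section Grid.
Variable h : nat.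

Definition grid_vertex := (nat * 'I_h)%type.

(* Euclidean distance 1, expressed by its square. *)
Definition grid_adj : rel grid_vertex := fun u v =>
  ((u.1%:Z - v.1%:Z) ^+ 2 + (u.2%:Z - v.2%:Z) ^+ 2 == 1 :> int).

Lemma finite_grid_nbrs (v : grid_vertex) : finite_set [set u | grid_adj v u].
Proof.
apply: (sub_finite_set _
  (finite_setX (finite_II v.1.+2) (@finite_finset 'I_h setT))) => u /= vu.
split=> //; rewrite /= ltnNge; apply/negP => le_vu.
have gap : 1 < u.1%:Z - v.1%:Z by rewrite ltrBrDr ltz_nat add1n.
move: vu; rewrite /grid_adj -sqrrN opprB; apply/negP.
by rewrite gt_eqF // ltr_wpDr ?sqr_ge0 // exprn_egt1.
Qed.

Definition top_left (h_gt0 : (0 < h)%N) : grid_vertex :=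
  (0%N, Ordinal (etrans (ltn_predL h) h_gt0)).

Definition displacement (v : grid_vertex) (p : seq grid_vertex) : nat :=
  (\max_(u <- v :: p) u.1 - \big[minn/v.1]_(u <- v :: p) u.1)%N.

End Grid.

(* [F n d] is the coefficient of x^n y^d. *)
Definition bivariate_fps := nat -> nat -> rat.

Definition fps_mul (F G : bivariate_fps) : bivariate_fps := fun n d =>
  \sum_(i < n.+1) \sum_(j < d.+1) F i j * G (n - i)%N (d - j)%N.

(* As in polyXY, y is the outer variable of {poly {poly rat}}. *)
Definition fps_of_poly (P : {poly {poly rat}}) : bivariate_fps :=
  fun n d => P`_d`_n.

Definition fps_rational (F : bivariate_fps) : Prop :=
  exists P Q : {poly {poly rat}},
    Q != 0 /\ fps_mul (fps_of_poly Q) F = fps_of_poly P.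

(* The index set of this finitely supported sum is finite, by [finite_walks]
   and [finite_grid_nbrs]. *)
Definition gsaw_gf (h : nat) (v : grid_vertex h) : bivariate_fps := fun n d =>
  \sum_(p \in gsaws (@grid_adj h) v `&`
              [set p | size p = n /\ displacement v p = d])
    uniform_prob (@grid_adj h) v p.

(* Main.v *)
Require Import Defs.
From mathcomp Require Import all_boot all_order all_algebra finmap.
From mathcomp Require Import boolp classical_sets functions cardinality fsbigop.
From mathcomp Require Import zify.

(* Write the generating function as the sum of A_D(x) y^D over the
   displacements D, where A_D is a polynomial.  Cutting a walk between two
   consecutive columns leaves a left word and a right word, each of which
   retains the visits to both columns adjacent to the cut.  All constraints and
   transition probabilities are local, so they are visible from one of the two
   words, and two words glue to a walk exactly when they agree on the visits
   to the two shared columns.  These shared visits range over a finite set S,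
   hence A_(i+j+2) is the sum over s in S of L_i(s) R_j(s): the Hankel matrix of
   (A_D) has finite rank, and a linear dependency between the rows L_0, ...,
   L_#|S| is a linear recurrence with coefficients in Q[x] for (A_D). *)

Set Implicit Arguments.
Unset Strict Implicit.
Unset Printing Implicit Defensive.

Import Order.TTheory GRing.Theory Num.Theory.

(** * Cutting and gluing walks *)

Section CutGraph.
Variables (V : eqType) (col : V -> nat) (adj : rel V).
Hypothesis adj_col :
  forall x y, adj x y -> (col x <= (col y).+1) && (col y <= (col x).+1).
Variable k : nat.

(** The sides overlap in columns [k] and [k.+1], so every vertex lies on one side together with all
    its neighbors. *)
Definition lside : pred V := fun x => col x <= k.+1.
Definition rside : pred V := fun x => k <= col x.

(* Consecutive vertices of the left word are adjacent in the walk or separated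
   by an excursion to the right, which starts and ends in column k.+1. *)
Definition lstep : rel V :=
  fun x y => adj x y || (k < col x) && (col y == k.+1).

(* The right word is preceded by a virtual vertex left of the cut, hence
   [col x <= k] instead of [col x == k]. *)
Definition rstep : rel V :=
  fun x y => adj x y || (col x <= k) && (col y == k).

(* When the walk is at x, the left and right words have last vertices xl and xr
   (or a virtual initial vertex left of the cut). *)
Definition cut_state (x xl xr : V) : Prop :=
  (col x <= k /\ xl = x /\ (xr = x \/ col x < k /\ col xr <= k)) \/
  (k < col x /\ xr = x /\ (xl = x \/ k.+1 < col x /\ k < col xl)).

(** Columns change by at most 1, so after a vertex hidden from one word, only the shared column
    nearest to it can be entered. *)
Lemma cut_path (p : seq V) (x xl xr : V) :
  cut_state x xl xr -> path adj x p ->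
  [/\ path lstep xl (filter lside p), path rstep xr (filter rside p)
    & cut_state (last x p) (last xl (filter lside p))
                           (last xr (filter rside p))].
Proof.
elim: p x xl xr => [|y p IHp] x xl xr //= st /andP[xy yp].
have /andP[cxy cyx] := adj_col xy.
have [yl|yl] := boolP (lside y); have [yr|yr] := boolP (rside y) => /=.
- have st' : cut_state y y y.
    rewrite /cut_state; case: (leqP (col y) k); [left|right];
      by do !split=> //; left.
  have [pl pr ps] := IHp _ _ _ st' yp; rewrite pl pr !andbT; split=> //.
    case: st => -[cx [e cc]]; rewrite /lstep ?e ?xy //.
    case: cc => [->|cc]; first by rewrite xy.
    by apply/orP; right; rewrite /lside /rside in yl yr *; lia.
  case: st => -[cx [e cc]]; rewrite /rstep ?e ?xy //.
  case: cc => [->|cc]; first by rewrite xy.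
  by apply/orP; right; rewrite /lside /rside in yl yr *; lia.
- have st' : cut_state y y xr.
    rewrite /rside in yr; left; split; [lia|split=> //]; right.
    by case: st => -[cx [xe cc]]; [case: cc => [->|cc]|]; rewrite ?xe; lia.
  have [pl pr ps] := IHp _ _ _ st' yp; rewrite pl pr andbT; split=> //.
  rewrite /rside in yr; case: st => -[cx [e cc]]; rewrite /lstep ?e ?xy //; lia.
- have st' : cut_state y xl y.
    rewrite /lside in yl; right; split; [lia|split=> //]; right.
    by case: st => -[cx [xe cc]]; [|case: cc => [->|cc]]; rewrite ?xe; lia.
  have [pl pr ps] := IHp _ _ _ st' yp; rewrite pl pr andbT; split=> //.
  rewrite /lside in yl; case: st => -[cx [e cc]]; rewrite /rstep ?e ?xy //; lia.
- by rewrite /lside /rside in yl yr; lia.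
Qed.

(** The word on the side of the cut where [x] lies dictates the next vertex, reached by a true
    adjacency. If that vertex is shared, it must also head the other word, since the shared parts
    agree. *)
Lemma glue_paths (l r : seq V) (x xl xr : V) :
  (col x <= k /\ xl = x /\ col xr <= k) \/
  (k < col x /\ xr = x /\ k < col xl) ->
  all lside l -> all rside r -> filter rside l = filter lside r ->
  path lstep xl l -> path rstep xr r ->
  exists p, [/\ path adj x p, filter lside p = l & filter rside p = r].
Proof.
have [n] := ubnP (size l + size r); elim: n l r x xl xr => // n IHn l r x xl xr.
move=> sz st al ar e pl pr; case: st => -[cx [ex cx']]; subst.
  case: l sz al e pl => [|a l] /= sz al e pl.
    case: r sz ar e pr => [|b r] /= sz ar e pr; first by exists [::].
    case/andP: ar => br _; case/andP: pr; rewrite /rstep.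
    (* A head [b] of the right word would not be shared, yet a right step from a column at most [k]
       cannot pass column [k.+1]. *)
    have [bl|bl] := boolP (lside b); first by rewrite bl in e.
    rewrite /lside in bl; case/orP => [/adj_col|]; lia.
  case/andP: al => al1 al; case/andP: pl => xa pl.
  have {}xa : adj x a by case/orP: xa => //; lia.
  have [ar1|ar1] := boolP (rside a); rewrite ?ar1 ?(negPf ar1) in e; last first.
    rewrite /rside -ltnNge in ar1.
    have [] := IHn l r a a xr _ _ al ar e pl pr;
      [lia | by left; split=> //; lia |].
    move=> p [ap le re]; exists (a :: p) => /=.
    by rewrite xa al1 le /rside leqNgt ar1; split.
  case: r sz ar e pr => [|b r] //= sz /andP[br ar] e /andP[xb pr].
  have bl : lside b.
    apply: contraT; rewrite /lside => bl.
    by move: xb; rewrite /rstep; case/orP => [/adj_col|]; lia.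
  rewrite bl in e; case: e => ab e; subst b.
  have [] := IHn l r a a a _ _ al ar e pl pr;
    [lia | by case: (leqP (col a) k); [left|right] |].
  move=> p [ap le re]; exists (a :: p) => /=.
  by rewrite xa al1 br le re; split.
case: r sz ar e pr => [|a r] /= sz ar e pr.
  case: l sz al e pl => [|b l] /= sz al e pl; first by exists [::].
  case/andP: al => bl _; case/andP: pl; rewrite /lstep.
  have [br|br] := boolP (rside b); first by rewrite br in e.
  rewrite /rside in br; case/orP => [/adj_col|]; lia.
case/andP: ar => ar1 ar; case/andP: pr => xa pr.
have {}xa : adj x a by case/orP: xa => //; lia.
have [al1|al1] := boolP (lside a); rewrite ?al1 ?(negPf al1) in e; last first.
  rewrite /lside -ltnNge in al1.
  have [] := IHn l r a xl a _ _ al ar e pl pr; [lia|by right; split=> //; lia|].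
  move=> p [ap le re]; exists (a :: p) => /=.
  by rewrite xa ar1 re /lside leqNgt al1; split.
case: l sz al e pl => [|b l] //= sz /andP[bl al] e /andP[xb pl].
have br : rside b.
  apply: contraT; rewrite /rside => br.
  by move: xb; rewrite /lstep; case/orP => [/adj_col|]; lia.
rewrite br in e; case: e => ab e; subst b.
have [] := IHn l r a a a _ _ al ar e pl pr;
    [lia | by case: (leqP (col a) k); [left|right] |].
move=> p [ap le re]; exists (a :: p) => /=.
by rewrite xa al1 br le re; split.
Qed.

(** Two successors of [x] are at most 2 columns apart, so they have a side in common, and its word
    determines both. *)
Lemma cut_inj (p q : seq V) (x : V) : path adj x p -> path adj x q ->
  filter lside p = filter lside q -> filter rside p = filter rside q -> p = q.
Proof.
have sideP y : lside y || rside y by rewrite /lside /rside; lia.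
have nil_side s : filter lside s = [::] -> filter rside s = [::] -> s = [::].
  by case: s => //= y s; have := sideP y; case: (lside y); case: (rside y).
elim: p q x => [|y p IHp] [|z q] x.
- by [].
- by move=> _ _ /esym le /esym re; rewrite (nil_side _ le re).
- by move=> _ _; apply: nil_side.
move=> /= /andP[xy yp] /andP[xz zq] le re.
have yz : y = z.
  have := sideP y; have := sideP z; move: le re.
  have := adj_col xy; have := adj_col xz.
  have [|] := boolP (lside y); have [|] := boolP (lside z);
    have [|] := boolP (rside y); have [|] := boolP (rside z) => //=;
    rewrite /lside /rside; try (by move=> ? ? ? ? ? ? [] //);
    try (by move=> ? ? ? ? ? ? ? []); lia.
subst z; congr cons; apply: (IHp _ y) => //.
  by move: le; case: (lside y) => // -[].
by move: re; case: (rside y) => // -[].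
Qed.

End CutGraph.

Local Open Scope ring_scope.
Local Open Scope classical_set_scope.

(** * Rationality from a Hankel factorization *)

Lemma exists_dependency (R : idomainType) (S : finType) (L : nat -> S -> R) :
  exists c : 'I_#|S|.+1 -> R,
    (exists i, c i != 0) /\ forall s, \sum_i c i * L i s = 0.
Proof.
(* The extra zero column makes the matrix square and singular, which yields a kernel vector over any
   integral domain. *)
pose M := \matrix_(i < #|S|.+1, j < #|S|.+1)
  (if unlift ord0 j is Some s then L i (enum_val s) else 0).
have /det0P[c c_neq0 cM0] : \det M == 0.
  rewrite (expand_det_col _ ord0) big1 // => i _.
  by rewrite mxE unlift_none mul0r.
exists (c ord0); split=> [|s].
  case/rV0Pn: c_neq0 => i ci; by exists i.
have := congr1 (fun A : 'rV_ _ => A ord0 (lift ord0 (enum_rank s))) cM0.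
rewrite !mxE => cMs; rewrite -[RHS]cMs; apply: eq_bigr => i _.
by rewrite !mxE liftK enum_rankK.
Qed.

Lemma fps_rational_hankel (S : finType) (m : nat) (A : nat -> {poly rat})
    (L R : nat -> S -> {poly rat}) :
  (forall i j, A (i + j + m)%N = \sum_s L i s * R j s) ->
  fps_rational (fun n d => (A d)`_n).
Proof.
move=> hankel; have [c [[i0 ci0] c0]] := exists_dependency L.
set N := #|S| in c i0 ci0 c0 *.
have rec j : \sum_(i < N.+1) c i * A (i + j + m)%N = 0.
  under eq_bigr do rewrite hankel mulr_sumr.
  rewrite exchange_big big1 // => s _.
  by under eq_bigr do rewrite mulrA; rewrite -mulr_suml c0 mul0r.
(* Reversing [c] turns the recurrence into the vanishing of all coefficients of the product from
   [N + m] on; the lower ones form [P]. *)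
pose Q := \poly_(t < N.+1) c (inord (N - t)).
pose P := \poly_(d < N + m) \sum_(t < d.+1) Q`_t * A (d - t)%N.
exists P, Q; split.
  apply/eqP => /polyP/(_ (N - i0)%N); rewrite coef_poly coef0 ltnS leq_subr.
  have le_i0 : (i0 <= N)%N by rewrite -ltnS.
  by rewrite subKn // inord_val => /eqP; rewrite (negPf ci0).
apply/funext => n; apply/funext => d.
rewrite /fps_mul /fps_of_poly exchange_big /=.
have -> : \sum_(t < d.+1) \sum_(i < n.+1) Q`_t`_i * (A (d - t)%N)`_(n - i) =
    (\sum_(t < d.+1) Q`_t * A (d - t)%N)`_n.
  by rewrite coef_sum; apply: eq_bigr => t _; rewrite coefM.
rewrite coef_poly; case: ltnP => // le_d.
congr (fun q : {poly rat} => q`_n).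
(* Both ranges, up to [d] and up to [N], are embedded in a common one; beyond [N] the coefficients
   of [Q] vanish. *)
rewrite (big_ord_widen_cond (d.+1 + N.+1) predT
  (fun t => Q`_t * A (d - t)%N)) ?leq_addr //.
rewrite (bigID (fun t : 'I__ => (t < N.+1)%N)) /= addrC big1 ?add0r; last first.
  by move=> t /andP[_ tN]; rewrite coef_poly (negPf tN) mul0r.
rewrite (eq_bigl (fun t : 'I__ => (t < N.+1)%N)); last by move=> t; lia.
rewrite -(big_ord_widen _ (fun t => Q`_t * A (d - t)%N)); last by lia.
rewrite (reindex_inj rev_ord_inj) /= -[RHS](rec (d - N - m)%N).
apply: eq_bigr => i _; rewrite coef_poly subSS ltnS leq_subr.
have le_i : (i <= N)%N by rewrite -ltnS.
by rewrite subKn // inord_val; congr (_ * A _); lia.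
Qed.

(** A term survives only if both codes agree, so it suffices that [e] reaches the codes of [s];
    injectivity of [e] avoids double counting. *)
Lemma sum_match (R : pzSemiRingType) (I J C : eqType) (S : finType) (e : S -> C)
    (s : seq I) (t : seq J) (f : I -> C) (g : J -> C)
    (F : I -> R) (G : J -> R) :
  injective e -> (forall a, a \in s -> exists x, e x = f a) ->
  \sum_(a <- s) \sum_(b <- t) (if f a == g b then F a * G b else 0) =
  \sum_x (\sum_(a <- s | f a == e x) F a) * (\sum_(b <- t | g b == e x) G b).
Proof.
move=> e_inj sP; under [RHS]eq_bigr do rewrite big_mkcond mulr_suml.
rewrite [RHS]exchange_big /=; apply: eq_big_seq => a /sP[x0 ex0].
rewrite (bigD1 x0) //= ex0 eqxx [X in _ + X]big1 ?addr0 => [|x x_neq0].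
  rewrite [X in _ * X]big_mkcond mulr_sumr; apply: eq_bigr => b _.
  by rewrite eq_sym; case: eqP; rewrite ?mulr0.
by rewrite -ex0 (inj_eq e_inj) eq_sym (negPf x_neq0) mul0r.
Qed.

(** * Weights and validity of the two halves *)

Section Weight.
Variables (V : choiceType) (adj : rel V).
Hypothesis fin_adj : forall u, finite_set [set w | adj u w].

Lemma num_unvisited_eq (s t : seq V) (c : V) :
  (forall u, adj c u -> (u \in s) = (u \in t)) ->
  num_unvisited adj s c = num_unvisited adj t c.
Proof.
move=> st; rewrite /num_unvisited; congr (#|` fset_set _|%fset).
by apply/seteqP; split=> u /= [cu us]; split=> //; [rewrite -st|rewrite st].
Qed.

Lemma num_unvisited_eq0P (s : seq V) (c : V) :
  reflect (forall u, adj c u -> u \in s) (num_unvisited adj s c == 0%N).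
Proof.
(* [fset_set] is empty by default on infinite sets, so finiteness is essential here. *)
have fin : finite_set [set u | adj c u /\ u \notin s].
  by apply: sub_finite_set (fin_adj c) => u [].
apply: (iffP idP) => [|all_s]; rewrite /num_unvisited cardfs_eq0.
  move=> /eqP s0 u cu; apply: contraT => us.
  have : u \in fset_set [set u | adj c u /\ u \notin s].
    by rewrite in_fset_set // inE.
  by rewrite s0.
apply/eqP/fsetP => u; rewrite in_fset_set // in_fset0.
by apply/negP; rewrite inE => -[/all_s ->].
Qed.

(* The maximum gives weight 1 to the trapped endpoint, which makes no step;
   at every other vertex of a walk some neighbor is unvisited. *)
Definition vertex_weight (s : seq V) (c : V) : rat :=
  (maxn 1 (num_unvisited adj s c))%:R^-1.

(* s is the part of the walk before w; only the vertices in P contribute. *)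
Fixpoint weight (P : pred V) (s w : seq V) : {poly rat} :=
  if w is c :: w' then
    (if P c then vertex_weight (rcons s c) c *: 'X else 1) *
      weight P (rcons s c) w'
  else 1.

(** [weight] skips the start, whose departure factor stands in front; the trapped endpoint
    contributes probability factor 1, and ['X] counts the vertices entered. *)
Lemma uniform_probE (v : V) (p : seq V) : gsaws adj v p ->
  uniform_prob adj v p *: 'X^(size p) =
    vertex_weight [:: v] v *: weight predT [:: v] p.
Proof.
rewrite /gsaws /uniform_prob /=.
suff gen s c : path adj c p -> uniq (rcons s c ++ p) ->
    num_unvisited adj (rcons s c ++ p) (last c p) = 0%N ->
    (\prod_(i < size p) (num_unvisited adj (s ++ take i.+1 (c :: p))
       (nth v (c :: p) i))%:R^-1) *: 'X^(size p) =
    vertex_weight (rcons s c) c *: weight predT (rcons s c) p.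
  by case=> vp up tp; apply: (gen [::]) => //; apply/eqP/num_unvisited_eq0P.
elim: p s c => [|y p IHp] s c /=.
  by rewrite cats0 big_ord0 /vertex_weight => _ _ ->.
move=> /andP[cy yp] us ts; rewrite big_ord_recl exprS /= ?take0 cats1.
(* The maximum with 1 changes nothing: [y] is still unvisited, so the count is positive. *)
have -> : (num_unvisited adj (rcons s c) c)%:R^-1 = vertex_weight (rcons s c) c.
  congr (_%:R^-1); apply/esym/maxn_idPr; rewrite lt0n.
  apply/negP => /num_unvisited_eq0P/(_ _ cy) ycs.
  by move: us; rewrite cat_uniq /= ycs !andbF.
rewrite -scalerA scalerAr; congr (_ *: _).
rewrite -scalerAl scalerAr -[vertex_weight _ y *: _]IHp ?cat_rcons //.
  congr (_ * (_ *: _)); apply: eq_bigr => i _.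
  by rewrite cat_rcons.
- by rewrite -cat_rcons.
- by rewrite -cat_rcons.
Qed.

Variables (col : V -> nat) (k : nat).
Hypothesis adj_col :
  forall x y, adj x y -> (col x <= (col y).+1)%N && (col y <= (col x).+1)%N.

Let lsd := lside col k.
Let rsd := rside col k.

Lemma num_unvisited_lside (s : seq V) (c : V) : (col c <= k)%N ->
  num_unvisited adj (filter lsd s) c = num_unvisited adj s c.
Proof.
move=> ck; apply: num_unvisited_eq => u /adj_col cu.
by rewrite mem_filter /lsd /lside (_ : (col u <= k.+1)%N); last lia.
Qed.

Lemma num_unvisited_rside (s : seq V) (c : V) : (k < col c)%N ->
  num_unvisited adj (filter rsd s) c = num_unvisited adj s c.
Proof.
move=> ck; apply: num_unvisited_eq => u /adj_col cu.
by rewrite mem_filter /rsd /rside (_ : (k <= col u)%N); last lia.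
Qed.

(** Each vertex is charged to exactly one half, and that half shows all its neighbors visited so
    far. *)
Lemma weight_cut (s w : seq V) :
  weight predT s w =
  weight (fun c => col c <= k)%N (filter lsd s) (filter lsd w) *
  weight (fun c => k < col c)%N (filter rsd s) (filter rsd w).
Proof.
elim: w s => [|c w IHw] s /=; first by rewrite mulr1.
have vl : (col c <= k)%N ->
    vertex_weight (rcons (filter lsd s) c) c = vertex_weight (rcons s c) c.
  move=> ck; rewrite /vertex_weight -(num_unvisited_lside (rcons s c) ck).
  by rewrite filter_rcons /lsd /lside leqW.
have vr : (k < col c)%N ->
    vertex_weight (rcons (filter rsd s) c) c = vertex_weight (rcons s c) c.
  move=> ck; rewrite /vertex_weight -(num_unvisited_rside (rcons s c) ck).
  by rewrite filter_rcons /rsd /rside ltnW.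
rewrite IHw !filter_rcons; have [ck|ck] := leqP (col c) k.
  have -> : lsd c by rewrite /lsd /lside leqW.
  rewrite /= ck vl // -mulrA; congr (_ * (_ * _)).
  by case: (rsd c) => //=; rewrite ltnNge ck mul1r.
have -> : rsd c by rewrite /rsd /rside ltnW.
rewrite /= ck vr // mulrCA; congr (_ * _).
by case: (lsd c) => //=; rewrite leqNgt ck mul1r.
Qed.

(** Trapping is tested only in the half where the walk ends; by [cut_state], the column of the last
    vertex of either word reveals which half that is. *)
Definition lvalid (v : V) (l : seq V) : bool :=
  [&& path (lstep col adj k) v l, uniq (v :: l), all lsd l
    & (col (last v l) <= k)%N ==>
      (num_unvisited adj (v :: l) (last v l) == 0%N)].

Definition rvalid (D : nat) (x : V) (r : seq V) : bool :=
  [&& path (rstep col adj k) x r, uniq r, all rsd r,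
      all (fun u => col u <= D)%N r, has (fun u => col u == D) r
    & (k < col (last x r))%N ==> (num_unvisited adj r (last x r) == 0%N)].

Definition gsaw_width (D : nat) (v : V) (p : seq V) : bool :=
  [&& path adj v p, uniq (v :: p),
      num_unvisited adj (v :: p) (last v p) == 0%N,
      all (fun u => col u <= D)%N (v :: p)
    & has (fun u => col u == D) (v :: p)].

Lemma gsaw_width_cut (D : nat) (v x : V) (p : seq V) :
  (col v < k)%N -> (col x < k)%N -> (k < D)%N ->
  path adj v p ->
  gsaw_width D v p = lvalid v (filter lsd p) && rvalid D x (filter rsd p).
Proof.
move=> vk xk kD vp; have st : cut_state col k v v x by left; do !split; lia.
have [] := cut_path adj_col st vp; rewrite -/lsd -/rsd => pl pr st'.
have lv : lsd v by rewrite /lsd /lside; lia.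
have rv : rsd v = false by rewrite /rsd /rside; lia.
have vD : (col v <= D)%N by lia.
have vD' : (col v == D) = false by lia.
rewrite /gsaw_width /lvalid /rvalid vp pl pr !filter_all /= vD vD' /=.
(* Filtering keeps all occurrences of a vertex on its side, and every vertex lies on some side. *)
have -> : uniq p = uniq (filter lsd p) && uniq (filter rsd p).
  apply/idP/andP => [up|[ul ur]]; first by rewrite !filter_uniq.
  apply/count_mem_uniq => u.
  have [lu|] := boolP (lsd u).
    have := count_uniq_mem u ul; rewrite mem_filter lu count_filter => <-.
    by apply: eq_count => y /=; case: eqP => //= ->; rewrite lu.
  rewrite /lsd /lside => lu; have ru : rsd u by rewrite /rsd /rside; lia.
  have := count_uniq_mem u ur; rewrite mem_filter ru count_filter => <-.
  by apply: eq_count => y /=; case: eqP => //= ->; rewrite ru.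
have -> : (v \in filter lsd p) = (v \in p) by rewrite mem_filter lv.
have -> : all (fun u => col u <= D)%N (filter rsd p) =
    all (fun u => col u <= D)%N p.
  rewrite all_filter; apply: eq_all => u /=; rewrite /rsd /rside.
  by case: (leqP k) => //= uk; apply/esym; lia.
have -> : has (fun u => col u == D) (filter rsd p) =
    has (fun u => col u == D) p.
  rewrite has_filter -filter_predI -has_filter; apply: eq_has => u /=.
  by rewrite /rsd /rside; case: eqP => //= ->; lia.
have -> : num_unvisited adj (v :: p) (last v p) == 0%N =
  ((col (last v (filter lsd p)) <= k)%N ==>
      (num_unvisited adj (v :: filter lsd p) (last v (filter lsd p)) == 0%N)) &&
  ((k < col (last x (filter rsd p)))%N ==>
      (num_unvisited adj (filter rsd p) (last x (filter rsd p)) == 0%N)).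
  have el : v :: filter lsd p = filter lsd (v :: p) by rewrite /= lv.
  have er : filter rsd p = filter rsd (v :: p) by rewrite /= rv.
  case: st' => -[ck [e e']].
    rewrite e ck el num_unvisited_lside //= ltnNge.
    suff -> : (col (last x (filter rsd p)) <= k)%N by rewrite andbT.
    by case: e' => [->|[_]].
  rewrite e ck er num_unvisited_rside // leqNgt.
  suff -> : (k < col (last v (filter lsd p)))%N by [].
  by case: e' => [->|[_]].
by rewrite -!andbA; do !bool_congr.
Qed.

End Weight.

(** * The half-infinite grid *)

Section GridCut.
Variable h : nat.
Let V := grid_vertex h.
Let adj : rel V := @grid_adj h.
Let col : V -> nat := fst.

Lemma grid_adj_col (u v : V) :
  grid_adj u v -> (u.1 <= v.1.+1)%N && (v.1 <= u.1.+1)%N.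
Proof.
move=> /eqP uv; have := sqr_ge0 (u.2%:Z - v.2%:Z); nia.
Qed.

(* Right words are shifted to start in column 1, so that their generating
   function does not depend on the position of the cut. *)
Definition shift (i : nat) (u : V) : V := ((u.1 + i)%N, u.2).

Lemma shift_inj i : injective (shift i).
Proof. by move=> [a b] [c d] [/addIn -> ->]. Qed.

Lemma grid_adj_shift i (u v : V) :
  grid_adj (shift i u) (shift i v) = grid_adj u v.
Proof. by rewrite /grid_adj /= !PoszD opprD addrACA subrr addr0. Qed.

(** A vertex of column 0 would gain a left neighbor under a positive shift, whence [0 < c.1]. *)
Lemma num_unvisited_shift i (s : seq V) (c : V) : (0 < c.1)%N ->
  num_unvisited adj (map (shift i) s) (shift i c) = num_unvisited adj s c.
Proof.
move=> c_gt0; rewrite /num_unvisited.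
have -> : [set u | adj (shift i c) u /\ u \notin map (shift i) s] =
    shift i @` [set u | adj c u /\ u \notin s].
  apply/seteqP; split=> [u /= [cu us]|_ [u [cu us] <-] /=]; last first.
    by rewrite /adj grid_adj_shift mem_map //; apply: shift_inj.
  have /andP[/= iu _] := grid_adj_col cu.
  have ue : u = shift i ((u.1 - i)%N, u.2).
    by rewrite /shift /= subnK -?surjective_pairing //; lia.
  rewrite ue in cu us *; exists ((u.1 - i)%N, u.2) => //.
  by rewrite /adj grid_adj_shift in cu; rewrite (mem_map (@shift_inj i)) in us.
rewrite fset_set_image; last first.
  by apply: sub_finite_set (finite_grid_nbrs c) => u [].
by rewrite card_imfset //=; apply: shift_inj.
Qed.

Lemma weight_shift k i (s r : seq V) :
  weight adj (fun c => k + i < col c)%N (map (shift i) s) (map (shift i) r) =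
  weight adj (fun c => k < col c)%N s r.
Proof.
elim: r s => //= c r IHr s; rewrite -map_rcons IHr ltn_add2r.
case: ifP => // kc; rewrite /vertex_weight num_unvisited_shift //.
exact: leq_ltn_trans kc.
Qed.

Lemma rvalid_shift k i D (x : V) (r : seq V) :
  rvalid adj col (k + i) (D + i) (shift i x) (map (shift i) r) =
  rvalid adj col k D x r.
Proof.
rewrite /rvalid path_map map_inj_uniq; last exact: shift_inj.
rewrite !all_map has_map last_map /= ltn_add2r.
congr [&& _, _, _, _, _ & _].
- apply: eq_path => u w /=.
  by rewrite /rstep /adj grid_adj_shift /= leq_add2r eqn_add2r.
- by apply: eq_all => u; rewrite /rside /= leq_add2r.
- by apply: eq_all => u /=; rewrite leq_add2r.
- by apply: eq_has => u /=; rewrite eqn_add2r.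
- have [kx|//] := boolP (k < col (last x r))%N.
  rewrite num_unvisited_shift //; exact: leq_ltn_trans kx.
Qed.

(** * Finiteness of the sets of words *)

(** A word without repetition over a finite alphabet [T] has length at most [#|T|]. *)
Lemma finite_bounded_words (D : nat) :
  finite_set [set p : seq V | uniq p && all (fun u => u.1 <= D)%N p].
Proof.
pose T : finType := ('I_D.+1 * 'I_h)%type; pose f (a : T) : V := (val a.1, a.2).
have f_inj : injective f by move=> [a b] [c d] [/val_inj -> ->].
have fin := @finite_finset {bseq #|T| of T} setT.
apply: sub_finite_set (finite_image (fun b => map f (val b)) fin).
move=> p /andP[up /allP pD] /=.
pose g (u : V) : T := (inord u.1, u.2).
have fg : map f (map g p) = p.
  rewrite -map_comp -[RHS]map_id; apply/eq_in_map => u /pD uD /=.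
  by rewrite /f /= inordK // -surjective_pairing.
have ug : uniq (map g p) by rewrite -(map_inj_uniq f_inj) fg.
have sg : (size (map g p) <= #|T|)%N.
  by rewrite -(card_uniqP ug) max_card.
by exists (Bseq sg).
Qed.

Lemma finite_gsaw_width D (v : V) :
  finite_set [set p | gsaw_width adj col D v p].
Proof.
apply: sub_finite_set (finite_bounded_words D) => p /and5P[_ + _ pD _] /=.
by move: pD; rewrite cons_uniq /= => /andP[_ ->] /andP[_ ->].
Qed.

Lemma finite_lvalid k (v : V) : finite_set [set l | lvalid adj col k v l].
Proof.
apply: sub_finite_set (finite_bounded_words k.+1) => l /and4P[_ + lk _] /=.
by rewrite cons_uniq; move: lk; rewrite /lside => -> /andP[_ ->].
Qed.

Lemma finite_rvalid k D (x : V) : finite_set [set r | rvalid adj col k D x r].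
Proof.
apply: sub_finite_set (finite_bounded_words D) => r /and5P[_ ur _ rD _] /=.
by rewrite ur.
Qed.

(** * From the generating function to polynomials *)

(** The start has column 0, so the displacement is the largest column. *)
Lemma gsaw_widthP D (v : V) (p : seq V) : v.1 = 0%N ->
  (gsaws adj v p /\ displacement v p = D) <-> gsaw_width adj col D v p.
Proof.
move=> v0.
have dispE : displacement v p = \max_(u <- v :: p) u.1.
  by rewrite /displacement [X in (_ - X)%N]big_cons v0 min0n subn0.
have maxE : (\max_(u <- v :: p) u.1 == D)%N =
    all (fun u => u.1 <= D)%N (v :: p) && has (fun u => u.1 == D) (v :: p).
  have le_max u : u \in v :: p -> (u.1 <= \max_(u <- v :: p) u.1)%N.
    by move=> up; apply: (@leq_bigmax_seq _ _ _ (fun u : V => u.1)).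
  apply/eqP/andP => [maxD|[/allP pD /hasP[u up /eqP uD]]].
    split; first by apply/allP => u /le_max; rewrite maxD.
    apply: contraT; rewrite -all_predC => /allP p_lt.
    have D_gt0 : (0 < D)%N.
      by have /eqP/= := p_lt v (mem_head _ _); rewrite v0; lia.
    suff : (\max_(u <- v :: p) u.1 <= D.-1)%N by rewrite maxD; lia.
    apply/bigmax_leqP_seq => u up _.
    by have := le_max u up; have /eqP/= := p_lt u up; rewrite maxD; lia.
  apply/eqP; rewrite eqn_leq -{2}uD le_max // andbT.
  by apply/bigmax_leqP_seq => w /pD.
split=> [[[vp up tp] pD]|/and5P[vp up /num_unvisited_eq0P tp aD hD]].
  rewrite /gsaw_width -maxE -dispE pD eqxx vp up !andbT /=.
  by apply/num_unvisited_eq0P => //; apply: finite_grid_nbrs.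
split; last by apply/eqP; rewrite dispE maxE aD hD.
by split=> //; apply: tp; apply: finite_grid_nbrs.
Qed.

(** Up to the departure factor of [v], this is the coefficient of [y^D] when [v] is in column 0. *)
Definition gsaw_poly (v : V) (D : nat) : {poly rat} :=
  \sum_(p <- fset_set [set p | gsaw_width adj col D v p])
    weight adj predT [:: v] p.

Lemma gsaw_gf_poly (v : V) (n D : nat) : v.1 = 0%N ->
  gsaw_gf v n D = (vertex_weight adj [:: v] v *: gsaw_poly v D)`_n.
Proof.
move=> v0; rewrite /gsaw_gf.
have -> : gsaws adj v `&` [set p | size p = n /\ displacement v p = D] =
    [set p | gsaw_width adj col D v p] `&` [set p | size p = n].
  apply/seteqP; split=> p /=.
    by move=> [pg [pn pD]]; split=> //; apply/gsaw_widthP.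
  by move=> [/(gsaw_widthP _ _ v0)[pg pD] pn].
rewrite fsbig_mkcondr fsbig_finite; last exact: finite_gsaw_width.
rewrite /gsaw_poly scaler_sumr coef_sum; apply: eq_big_seq => p.
rewrite in_fset_set; last exact: finite_gsaw_width.
rewrite inE /= => /(gsaw_widthP _ _ v0)[pg _].
rewrite -uniform_probE //; last exact: finite_grid_nbrs.
rewrite coefZ coefXn; have [->|pn] := eqVneq n (size p).
  by rewrite mem_set // mulr1.
by rewrite memNset ?mulr0 // => /esym/eqP; rewrite (negPf pn).
Qed.

(* The cut lies between columns i.+1 and i.+2, so the start vertex, in column 0,
   belongs to neither of the shared columns. *)
Definition code (i : nat) (u : V) : bool * 'I_h := (u.1 == i.+1, u.2).

(** Left words are cut after column [i.+1] and right words after column 1; the codes forget this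
    difference. *)
Definition lcode (i : nat) (l : seq V) :=
  map (code i) (filter (rside col i.+1) l).
Definition rcode (r : seq V) :=
  map (code 0) (filter (lside col 1) r).

(** On the two shared columns [code i] is injective, with inverse [decode]. *)
Lemma code_agree i (l r : seq V) :
  all (lside col i.+1) l -> all (rside col 1) r ->
  (lcode i l == rcode r) =
  (filter (rside col i.+1) l == filter (lside col i.+1) (map (shift i) r)).
Proof.
move=> al ar.
have -> : rcode r = map (code i) (filter (lside col i.+1) (map (shift i) r)).
  rewrite filter_map -map_comp /rcode; congr map.
    by apply/funext => u; rewrite /code /= -[i.+1]add1n eqn_add2r.
  by apply: eq_filter => u; rewrite /lside /= -[i.+2]/(2 + i)%N leq_add2r.
rewrite /lcode; apply/eqP/eqP => [|-> //].
pose decode (a : bool * 'I_h) : V := ((if a.1 then i.+1 else i.+2), a.2).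
have codeK (s : seq V) : all (lside col i.+1) s -> all (rside col i.+1) s ->
    map decode (map (code i) s) = s.
  move=> /allP sl /allP sr; rewrite -map_comp -[RHS]map_id.
  apply/eq_in_map => -[a b] ab /=; rewrite /decode /code /=.
  have := sl _ ab; have := sr _ ab; rewrite /lside /rside /= => a1 a2.
  by congr pair; case: eqP => [->//|]; lia.
have al' : all (lside col i.+1) (filter (rside col i.+1) l).
  by rewrite all_filter; apply: sub_all al => u /= ->; apply: implybT.
have ar' : all (rside col i.+1) (filter (lside col i.+1) (map (shift i) r)).
  rewrite all_filter all_map; apply: sub_all ar => u /= ur; apply/implyP => _.
  by move: ur; rewrite /rside /col /=; lia.
by move=> /(congr1 (map decode)); rewrite !codeK ?filter_all.
Qed.

(** * The Hankel factorization *)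

Definition lpoly (v : V) (i : nat) (s : seq (bool * 'I_h)) : {poly rat} :=
  \sum_(l <- fset_set [set l | lvalid adj col i.+1 v l] | lcode i l == s)
    weight adj (fun c => col c <= i.+1)%N [:: v] l.

(** Shifting back by [i] moves the cut from [i.+1] to 1 and the last column from [i + j + 2] to
    [j.+2], leaving no dependence on [i]. *)
Definition rpoly (v : V) (j : nat) (s : seq (bool * 'I_h)) : {poly rat} :=
  \sum_(r <- fset_set [set r | rvalid adj col 1 j.+2 v r] | rcode r == s)
    weight adj (fun c => 1 < col c)%N [::] r.

(** [split_walk] is a bijection from walks to pairs of valid words with equal codes, and the weight
    of a walk is the product of those of its halves. *)
Lemma gsaw_poly_hankel (v : V) (i j : nat) : v.1 = 0%N ->
  gsaw_poly v (i + j + 2) =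
  \sum_(s : {bseq #|{: bool * 'I_h}| of bool * 'I_h}) lpoly v i s * rpoly v j s.
Proof.
move=> v0.
pose LL := fset_set [set l | lvalid adj col i.+1 v l].
pose RR := fset_set [set r | rvalid adj col 1 j.+2 v r].
pose W := fset_set [set p | gsaw_width adj col (i + j + 2) v p].
have LLP l : (l \in LL) = lvalid adj col i.+1 v l.
  by rewrite in_fset_set ?mem_setE //; exact: finite_lvalid.
have RRP r : (r \in RR) = rvalid adj col 1 j.+2 v r.
  by rewrite in_fset_set ?mem_setE //; exact: finite_rvalid.
have WP p : (p \in W) = gsaw_width adj col (i + j + 2) v p.
  by rewrite in_fset_set ?mem_setE //; exact: finite_gsaw_width.
pose Y := [seq x <- [seq (l, r) | l <- LL, r <- RR] | lcode i x.1 == rcode x.2].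
pose unshift (u : V) : V := ((u.1 - i)%N, u.2).
pose split_walk p :=
  (filter (lside col i.+1) p, map unshift (filter (rside col i.+1) p)).
have shiftK p : map (shift i) (split_walk p).2 = filter (rside col i.+1) p.
  rewrite -map_comp -[RHS]map_id; apply/eq_in_map => -[a b].
  rewrite mem_filter /rside /shift /col /= => /andP[ia _].
  by rewrite subnK //; lia.
have agreeP p : lcode i (split_walk p).1 == rcode (split_walk p).2.
  rewrite code_agree ?shiftK ?filter_all //=.
    rewrite -!filter_predI; apply/eqP; apply: eq_filter => u /=.
    exact: andbC.
  rewrite all_map all_filter; apply/allP => u _ /=; rewrite /rside /col /=.
  by apply/implyP; lia.
have cutP p : path adj v p ->
    gsaw_width adj col (i + j + 2) v p =
    (lvalid adj col i.+1 v (split_walk p).1) &&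
    (rvalid adj col 1 j.+2 v (split_walk p).2).
  move=> vp; rewrite -(rvalid_shift 1 i) shiftK add1n.
  rewrite (_ : j.+2 + i = i + j + 2)%N; last by lia.
  by apply: (gsaw_width_cut grid_adj_col) => //=; rewrite /col /= ?v0; lia.
have YW : perm_eq (map split_walk W) Y.
  apply: uniq_perm.
  - rewrite map_inj_in_uniq ?fset_uniq // => p q; rewrite !WP.
    move=> /and5P[vp _ _ _ _] /and5P[vq _ _ _ _] [el er].
    apply: (cut_inj grid_adj_col vp vq el).
    by rewrite -shiftK -[RHS]shiftK /= er.
  - rewrite filter_uniq // allpairs_uniq ?fset_uniq //.
    by move=> -[? ?] [? ?] _ _ [-> ->].
  move=> [l r]; rewrite mem_filter /=; apply/mapP/andP.
    case=> p; rewrite WP => pW e; have vp : path adj v p by case/and5P: pW.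
    move: (pW); rewrite cutP // -e => /andP[lv rv].
    move: (agreeP p); rewrite -e => ->; split=> //.
    by apply/allpairsP; exists (l, r); rewrite LLP RRP.
  case=> agr /allpairsP[[l' r'] /= [+ + [el er]]]; rewrite -{}el -{}er LLP RRP.
  move=> lv rv; have [pl _ al _] := and4P lv.
  have [_ _ ar _ _ ] := and5P rv.
  have rv' := rv; rewrite -(rvalid_shift 1 i) in rv'.
  have [pr _ ar' _ _] := and5P rv'.
  rewrite code_agree // in agr.
  (* The vertex [shift i v], in column [i], is the virtual vertex before the shifted right word. *)
  have st : (col v <= i.+1 /\ v = v /\ col (shift i v) <= i.+1)%N \/
     (i.+1 < col v /\ shift i v = v /\ i.+1 < col v)%N.
    by left; rewrite /col /= v0; do !split; lia.
  have [p [vp pl' pr']] := glue_paths grid_adj_col st al ar' (eqP agr) pl pr.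
  have e : (l, r) = split_walk p.
    congr pair; first by rewrite pl'.
    by apply: (inj_map (@shift_inj i)); rewrite shiftK pr'.
  by exists p => //; rewrite WP cutP // -e lv rv.
rewrite /gsaw_poly -/W.
transitivity (\sum_(x <- Y) weight adj (fun c => col c <= i.+1)%N [:: v] x.1 *
                            weight adj (fun c => 1 < col c)%N [::] x.2).
  rewrite -(perm_big _ YW) big_map; apply: eq_big_seq => p _.
  rewrite (weight_cut i.+1 grid_adj_col).
  rewrite -(weight_shift 1 i) shiftK /=.
  by rewrite /lside /rside /= v0.
rewrite big_filter big_mkcond big_allpairs /=.
apply: sum_match => [|l]; first exact: val_inj.
rewrite LLP => /and4P[_ + al _]; rewrite cons_uniq => /andP[_ ul].
(* Without repetition, a code is no longer than its alphabet is large, so the bounded sequences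
   contain every code. *)
have uc : uniq (lcode i l).
  rewrite map_inj_in_uniq ?filter_uniq // => -[a b] [c d].
  rewrite !mem_filter /rside /=.
  move=> /andP[ia /(allP al) ai] /andP[ic /(allP al) ci].
  rewrite /lside /code /col /= in ia ai ic ci * => -[ac ->]; congr pair.
  by move: ac; do 2!case: eqP; lia.
have sc : (size (lcode i l) <= #|{: bool * 'I_h}|)%N.
  by rewrite -(card_uniqP uc) max_card.
by exists (Bseq sc).
Qed.

End GridCut.

Theorem theorem5p1 (h : nat) (h_gt0 : (0 < h)%N) :
  fps_rational (gsaw_gf (top_left h_gt0)).
Proof.
set v := top_left h_gt0; have v0 : v.1 = 0%N by [].
have -> : gsaw_gf v = fun n D =>
    (vertex_weight (@grid_adj h) [:: v] v *: gsaw_poly v D)`_n.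
  by apply/funext => n; apply/funext => D; apply: gsaw_gf_poly.
(* The offset 2 leaves out displacements 0 and 1, too small for a cut with column 0 left of both
   shared columns. The departure factor of [v] is absorbed on the left. *)
apply: (@fps_rational_hankel _ 2 _
  (fun i s => vertex_weight (@grid_adj h) [:: v] v *: lpoly v i (val s))
  (fun j s => rpoly v j (val s))) => i j.
rewrite gsaw_poly_hankel // scaler_sumr; apply: eq_bigr => s _.
by rewrite scalerAl.
Qed.
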